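(* Let $n\ge 2$ and let $L$ be a finite dimensional filiform $n$-Lie algebra over a field $\mathbb{F}$ of characteristic zero. Then $$\dim\mathcal{M}(L)=\dim\mathcal{M}(L/Z(L))+t$$ for some integer $t$ with $-1\leq t\leq n-1$.
   Context: Fix a field $\mathbb{F}$ of characteristic zero and an integer $n\ge 2$. An $n$-Lie algebra is a vector space $L$ with an $n$-linear alternating bracket $[-,\ldots,-]:L^{\times n}\to L$ satisfying the Filippov-Jacobi identity $[x_1,\ldots,x_{n-1},[y_1,\ldots,y_n]]=\sum_{i=1}^{n}[y_1,\ldots,y_{i-1},[x_1,\ldots,x_{n-1},y_i],y_{i+1},\ldots,y_n]$. The center is $Z(L)=\{z\in L\mid[z,L,\ldots,L]=0\}$. Put $L^1=L$ and $L^{i+1}=[L^i,L,\ldots,L]$ (span of brackets) for $i\ge1$; in particular $L^2=[L,\ldots,L]$. An $m$-dimensional $n$-Lie algebra $L$ with $m\ge n$ is called filiform if $\dim L^i=m-n-i+2$ for every $2\le i\le m-n+2$ (so $L^{m-n+2}=0$, and $L$ is nilpotent of class $m-n+1$). The Schur multiplier of $L$ is $\mathcal{M}(L)=\dfrac{R\cap F^2}{[R,F,\ldots,F]}$, where $0\to R\to F\to L\to 0$ is a free presentation of $L$ (a short exact sequence with $F$ a free $n$-Lie algebra); up to isomorphism it is independent of the free presentation. *)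

(* Defs.v *)
From HB Require Import structures.
From mathcomp Require Import all_boot all_order all_fingroup all_algebra.
From mathcomp Require Import generic_quotient.
From mathcomp Require Import boolp classical_sets.

Set Implicit Arguments.
Unset Strict Implicit.
Unset Printing Implicit Defensive.

Import Order.TTheory GRing.Theory Num.Theory.
Local Open Scope quotient_scope.
Local Open Scope classical_set_scope.
Local Open Scope ring_scope.

Definition upd (n : nat) (T : Type) (x : {ffun 'I_n -> T}) (i : 'I_n) (u : T) :
  {ffun 'I_n -> T} := [ffun j => if j == i then u else x j].

(* In the Filippov-Jacobi identity [l] is the last position, so that           *)
(* [bracket (upd x l v)] is [x_1, ..., x_{n-1}, v] and [x l] plays no role.    *)
HB.mixin Record Lmodule_isNLie (F : fieldType) (n : nat) L
    of GRing.Lmodule F L := {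
  bracket : {ffun 'I_n -> L} -> L;
  bracket_linear : forall (x : {ffun 'I_n -> L}) (i : 'I_n) (a : F) (u v : L),
    bracket (upd x i (a *: u + v)) = a *: bracket (upd x i u) + bracket (upd x i v);
  bracket_alt : forall (x : {ffun 'I_n -> L}) (i j : 'I_n),
    i != j -> x i = x j -> bracket x = 0;
  bracket_filippov : forall (x y : {ffun 'I_n -> L}) (l : 'I_n),
    l.+1 = n :> nat ->
    bracket (upd x l (bracket y))
      = \sum_(i < n) bracket (upd y i (bracket (upd x l (y i))))
}.

#[short(type="nLieType")]
HB.structure Definition NLie (F : fieldType) (n : nat) :=
  {L of GRing.Lmodule F L & Lmodule_isNLie F n L}.

Section Subspaces.
Variables (F : fieldType) (V : lmodType F).
Implicit Types A B S : set V.

Definition lspan S : set V :=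
  [set v | exists k (c : 'I_k -> F) (b : 'I_k -> V),
     (forall i, S (b i)) /\ v = \sum_(i < k) c i *: b i].

(* [dim_mod A B d]: the quotient A / B has dimension d, i.e. some d elements   *)
(* of A form a basis of A modulo B.                                            *)
Definition dim_mod A B (d : nat) : Prop :=
  exists b : 'I_d -> V,
  [/\ forall i, A (b i),
      forall v, A v -> exists c : 'I_d -> F, B (v - \sum_(i < d) c i *: b i)
    & forall c : 'I_d -> F, B (\sum_(i < d) c i *: b i) -> forall i, c i = 0].

Definition has_dim A (d : nat) : Prop := dim_mod A [set 0] d.

End Subspaces.

Section NLieTheory.
Variables (F : fieldType) (n : nat).
Implicit Types L M : nLieType F n.

(* [A, L, ..., L]; the index i with value 0 is the first position.             *)
Definition brackets L (A : set L) : set L :=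
  lspan [set u | exists x : {ffun 'I_n -> L},
    (forall i : 'I_n, i = 0%N :> nat -> A (x i)) /\ u = bracket x].

(* L^i for i >= 1 (and L^0 = L^1 = L).                                         *)
Definition lcs L (i : nat) : set L := iter i.-1 (@brackets L) setT.
Arguments lcs : clear implicits.

Definition filiform L : Prop :=
  exists m : nat,
  [/\ has_dim [set: L] m, (n <= m)%N
    & forall i : nat, (2 <= i <= m - n + 2)%N -> has_dim (lcs L i) (m - n + 2 - i)].

Definition nl_center L : set L :=
  [set z | forall (x : {ffun 'I_n -> L}) (i : 'I_n),
     i = 0%N :> nat -> x i = z -> bracket x = 0].
Arguments nl_center : clear implicits.

Definition is_hom L M (f : L -> M) : Prop :=
  forall x : {ffun 'I_n -> L}, f (bracket x) = bracket [ffun i => f (x i)].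

Definition is_free_on (X : Type) L (iota : X -> L) : Prop :=
  forall (M : nLieType F n) (g : X -> M),
  exists f : {linear L -> M},
  [/\ is_hom f, forall s, f (iota s) = g s
    & forall f' : {linear L -> M},
        is_hom f' -> (forall s, f' (iota s) = g s) -> f' =1 f].

Definition is_free L : Prop := exists (X : Type) (iota : X -> L), is_free_on iota.

Record free_presentation L := FreePresentation {
  fp_alg : nLieType F n;
  fp_map : {linear fp_alg -> L};
  fp_free : is_free fp_alg;
  fp_hom : is_hom fp_map;
  fp_surj : forall y : L, exists x : fp_alg, fp_map x = y }.

Definition fp_rel L (P : free_presentation L) : set (fp_alg P) :=
  [set x | fp_map P x = 0].
Arguments fp_rel {L} P.

(* dim M(L) = d, M(L) being computed from any free presentation of L; see      *)
(* [free_presentation_exists] below.                                           *)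
Definition multiplier_dim L (d : nat) : Prop :=
  forall P : free_presentation L,
    dim_mod (fp_rel P `&` lcs (fp_alg P) 2) (brackets (fp_rel P)) d.

End NLieTheory.
Arguments lcs {F n} L i.
Arguments fp_rel {F n L} P.
Arguments nl_center {F n} L.

Section Bracket.
Variables (F : fieldType) (n : nat) (L : nLieType F n).
Implicit Types x y : {ffun 'I_n -> L}.

Lemma upd_id x i : upd x i (x i) = x.
Proof. by apply/ffunP => j; rewrite ffunE; case: eqP => // ->. Qed.

Lemma bracket0 x i : x i = 0 -> bracket x = 0.
Proof.
move=> xi; have := bracket_linear x i (-1) 0 0.
by rewrite scaleN1r oppr0 addr0 -{1 2 3}xi upd_id scaleN1r addNr.
Qed.

Lemma bracket_tperm x (i j : 'I_n) : i != j ->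
  bracket [ffun k => x (tperm i j k)] = - bracket x.
Proof.
move=> ij; set u := x i; set v := x j.
pose B a b := bracket (upd (upd x i a) j b).
have Bl a a' b : B (a + a') b = B a b + B a' b.
  have E c : upd (upd x i c) j b = upd (upd x j b) i c.
    apply/ffunP => k; rewrite !ffunE.
    by case: eqP => // ->; case: eqP => // e; rewrite -e eqxx in ij.
  by have := bracket_linear (upd x j b) i 1 a a'; rewrite /B !E !scale1r.
have Br a b b' : B a (b + b') = B a b + B a b'.
  by have := bracket_linear (upd x i a) j 1 b b'; rewrite !scale1r.
have Bd a : B a a = 0.
  by apply: (bracket_alt _ _ _ ij); rewrite !ffunE !eqxx (negbTE ij).
have := Bd (u + v); rewrite Bl !Br !Bd addr0 add0r => /eqP.
rewrite addrC addr_eq0 => /eqP E.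
have -> : [ffun k => x (tperm i j k)] = upd (upd x i v) j u.
  apply/ffunP => k; rewrite !ffunE; case: tpermP => [->|->|/eqP/negbTE-> /eqP/negbTE->//].
    by rewrite (negbTE ij) eqxx.
  by rewrite eqxx.
rewrite -/(B v u) E; congr (- bracket _).
by rewrite /u /v; apply/ffunP => k; rewrite !ffunE; case: eqP => [->//|_]; case: eqP => [->|].
Qed.

Lemma bracket_center x i : nl_center L (x i) -> bracket x = 0.
Proof.
move=> zi; pose o := Ordinal (leq_ltn_trans (leq0n i) (ltn_ord i)).
have [ei|i0] := eqVneq i o; first by apply: (zi x o) => //; rewrite ei.
apply: oppr_inj; rewrite oppr0 -(bracket_tperm x i0).
by apply: (zi _ o) => //; rewrite ffunE tpermR.
Qed.

End Bracket.

Record ideal (F : fieldType) (n : nat) (L : nLieType F n) := Ideal {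
  ideal_set :> L -> Prop;
  ideal0 : ideal_set 0;
  idealZD : forall (a : F) u v, ideal_set u -> ideal_set v -> ideal_set (a *: u + v);
  ideal_bracket : forall (x : {ffun 'I_n -> L}) (i : 'I_n),
    ideal_set (x i) -> ideal_set (bracket x) }.

Section Quotient.
Variables (F : fieldType) (n : nat) (L : nLieType F n) (I : ideal L).

Definition ideal_equiv : rel L := fun u v => `[< I (u - v) >].

Lemma idealD u v : I u -> I v -> I (u + v).
Proof. by move=> Iu Iv; rewrite -[u]scale1r; apply: idealZD. Qed.

Lemma idealZ a u : I u -> I (a *: u).
Proof. by move=> Iu; rewrite -[_ *: _]addr0; apply: idealZD => //; apply: ideal0. Qed.

Lemma ideal_equiv_refl : reflexive ideal_equiv.
Proof. by move=> u; apply/asboolP; rewrite subrr; apply: ideal0. Qed.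

Lemma ideal_equiv_sym : symmetric ideal_equiv.
Proof.
by move=> u v; apply/asboolP/asboolP => /(idealZ (-1)); rewrite scaleN1r opprB.
Qed.

Lemma ideal_equiv_trans : transitive ideal_equiv.
Proof.
move=> v u w /asboolP Iuv /asboolP Ivw; apply/asboolP.
by have := idealD Iuv Ivw; rewrite addrA subrK.
Qed.

Canonical ideal_equivR :=
  EquivRel ideal_equiv ideal_equiv_refl ideal_equiv_sym ideal_equiv_trans.

Definition quot := {eq_quot ideal_equiv}.
HB.instance Definition _ := Choice.on quot.
HB.instance Definition _ := EqQuotient.on quot.

Definition quot_pi (u : L) : quot := \pi_quot u.

Lemma quot_piP u v : quot_pi u = quot_pi v <-> I (u - v).
Proof.
have E : reflect (quot_pi u = quot_pi v) (ideal_equiv u v) by apply: eqquotP.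
by split=> [/E/asboolP|/asboolP/E].
Qed.

Lemma quot_reprK (p : quot) : quot_pi (repr p) = p.
Proof. exact: reprK. Qed.

Lemma quot_repr u : I (repr (quot_pi u) - u).
Proof. by apply/quot_piP; rewrite quot_reprK. Qed.

Definition quot_add (p q : quot) : quot := quot_pi (repr p + repr q).
Definition quot_opp (p : quot) : quot := quot_pi (- repr p).
Definition quot_scale (a : F) (p : quot) : quot := quot_pi (a *: repr p).
Definition quot_bracket (x : {ffun 'I_n -> quot}) : quot :=
  quot_pi (bracket [ffun i => repr (x i)]).

Lemma quot_addE u v : quot_add (quot_pi u) (quot_pi v) = quot_pi (u + v).
Proof.
by apply/quot_piP; rewrite opprD addrACA; apply: idealD; apply: quot_repr.
Qed.

Lemma quot_oppE u : quot_opp (quot_pi u) = quot_pi (- u).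
Proof.
apply/quot_piP; rewrite -opprD -scaleN1r; apply: idealZ; exact: quot_repr.
Qed.

Lemma quot_scaleE a u : quot_scale a (quot_pi u) = quot_pi (a *: u).
Proof.
by apply/quot_piP; rewrite -scalerBr; apply: idealZ; apply: quot_repr.
Qed.

Lemma quot_ind (K : quot -> Prop) : (forall u, K (quot_pi u)) -> forall p, K p.
Proof. by move=> H p; rewrite -[p]quot_reprK. Qed.

Fact quot_addA : associative quot_add.
Proof. by do 3!elim/quot_ind=> ?; rewrite !quot_addE addrA. Qed.
Fact quot_addC : commutative quot_add.
Proof. by do 2!elim/quot_ind=> ?; rewrite !quot_addE addrC. Qed.
Fact quot_add0 : left_id (quot_pi 0) quot_add.
Proof. by elim/quot_ind=> ?; rewrite quot_addE add0r. Qed.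
Fact quot_addN : left_inverse (quot_pi 0) quot_opp quot_add.
Proof. by elim/quot_ind=> ?; rewrite quot_oppE quot_addE addNr. Qed.

HB.instance Definition _ :=
  GRing.isZmodule.Build quot quot_addA quot_addC quot_add0 quot_addN.

Lemma quot_piD u v : quot_pi (u + v) = quot_pi u + quot_pi v.
Proof. by rewrite -quot_addE. Qed.

Fact quot_scaleA a b p : quot_scale a (quot_scale b p) = quot_scale (a * b) p.
Proof. by elim/quot_ind: p => ?; rewrite !quot_scaleE scalerA. Qed.
Fact quot_scale1 : left_id 1 quot_scale.
Proof. by elim/quot_ind=> ?; rewrite quot_scaleE scale1r. Qed.
Fact quot_scaleDr : right_distributive quot_scale +%R.
Proof.
by move=> a; do 2!elim/quot_ind=> ?; rewrite -quot_piD !quot_scaleE -quot_piD scalerDr.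
Qed.
Fact quot_scaleDl p : {morph quot_scale^~ p : a b / a + b}.
Proof.
by elim/quot_ind: p => ? a b /=; rewrite !quot_scaleE -quot_piD scalerDl.
Qed.

HB.instance Definition _ := GRing.Zmodule_isLmodule.Build F quot
  quot_scaleA quot_scale1 quot_scaleDr quot_scaleDl.

Fact quot_pi_linear : linear quot_pi.
Proof. by move=> a u v; rewrite quot_piD -quot_scaleE. Qed.

HB.instance Definition _ := GRing.isLinear.Build F L quot *:%R quot_pi quot_pi_linear.

Lemma bracket_congr (x y : {ffun 'I_n -> L}) :
  (forall i, I (x i - y i)) -> I (bracket x - bracket y).
Proof.
move=> xy; pose z k : {ffun 'I_n -> L} := [ffun i : 'I_n => if (i < k)%N then x i else y i].
have -> : x = z n by apply/ffunP => i; rewrite ffunE ltn_ord.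
have -> : y = z 0%N by apply/ffunP => i; rewrite ffunE ltn0.
suff H k : (k <= n)%N -> I (bracket (z k) - bracket (z 0%N)) by apply: H.
elim: k => [|k IH] kn.
  by rewrite subrr; apply: ideal0.
have -> : bracket (z k.+1) - bracket (z 0%N) =
  (bracket (z k.+1) - bracket (z k)) + (bracket (z k) - bracket (z 0%N)).
  by rewrite addrA subrK.
apply: idealD (IH (ltnW kn)); pose i := Ordinal kn.
have -> : z k.+1 = upd (z k) i (x i).
  apply/ffunP => j; rewrite !ffunE ltnS leq_eqVlt -[j == i]/(j == k :> nat).
  by case: eqP => //= e; congr (x _); apply/val_inj.
have -> : z k = upd (z k) i (y i).
  apply/ffunP => j; rewrite !ffunE -[j == i]/(j == k :> nat).
  by case: eqP => //= e; rewrite e ltnn; congr (y _); apply/val_inj.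
set w := upd (z k) i (y i).
have updw u : upd w i u = upd (z k) i u.
  by apply/ffunP => j; rewrite !ffunE; case: eqP.
have := bracket_linear (z k) i (-1) (y i) (x i).
rewrite !scaleN1r addrC [RHS]addrC updw -/w => <-.
by apply: (@ideal_bracket _ _ _ I _ i); rewrite ffunE eqxx.
Qed.

Lemma quot_bracketE (x : {ffun 'I_n -> L}) :
  quot_bracket [ffun i => quot_pi (x i)] = quot_pi (bracket x).
Proof.
by apply/quot_piP/bracket_congr => i; rewrite !ffunE; apply: quot_repr.
Qed.

Lemma quot_ffunP (x : {ffun 'I_n -> quot}) :
  exists y : {ffun 'I_n -> L}, x = [ffun i => quot_pi (y i)].
Proof.
by exists [ffun j => repr (x j)]; apply/ffunP => i; rewrite !ffunE quot_reprK.
Qed.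

Lemma quot_upd (x : {ffun 'I_n -> L}) i u :
  upd [ffun j => quot_pi (x j)] i (quot_pi u) = [ffun j => quot_pi (upd x i u j)].
Proof. by apply/ffunP => j; rewrite !ffunE; case: eqP. Qed.

Fact quot_bracket_linear (x : {ffun 'I_n -> quot}) i (a : F) (u v : quot) :
  quot_bracket (upd x i (a *: u + v)) =
    a *: quot_bracket (upd x i u) + quot_bracket (upd x i v).
Proof.
have [{}x ->] := quot_ffunP x.
elim/quot_ind: u => u; elim/quot_ind: v => v.
by rewrite -linearP !quot_upd !quot_bracketE -linearP bracket_linear.
Qed.

Fact quot_bracket_alt (x : {ffun 'I_n -> quot}) i j :
  i != j -> x i = x j -> quot_bracket x = 0.
Proof.
move=> ij xij.
rewrite /quot_bracket (bracket_alt _ _ _ ij) ?linear0 //.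
by rewrite !ffunE xij.
Qed.

Fact quot_bracket_filippov (x y : {ffun 'I_n -> quot}) (l : 'I_n) :
  l.+1 = n :> nat ->
  quot_bracket (upd x l (quot_bracket y))
    = \sum_(i < n) quot_bracket (upd y i (quot_bracket (upd x l (y i)))).
Proof.
move=> ln; have [[{}x ->] [{}y ->]] := (quot_ffunP x, quot_ffunP y).
rewrite quot_bracketE quot_upd quot_bracketE bracket_filippov // linear_sum.
by apply: eq_bigr => i _; rewrite ffunE !(quot_upd, quot_bracketE).
Qed.

HB.instance Definition _ := Lmodule_isNLie.Build F n quot
  quot_bracket_linear quot_bracket_alt quot_bracket_filippov.

End Quotient.

Section CenterIdeal.
Variables (F : fieldType) (n : nat) (L : nLieType F n).

Fact center0 : nl_center L 0.
Proof. by move=> x i _; apply: bracket0. Qed.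

Fact centerZD (a : F) u v : nl_center L u -> nl_center L v -> nl_center L (a *: u + v).
Proof.
move=> zu zv x i i0 xi; rewrite -(upd_id x i) xi bracket_linear.
rewrite (zu _ i) ?(zv _ i) ?ffunE ?eqxx //.
by rewrite scaler0 addr0.
Qed.

Fact center_bracket (x : {ffun 'I_n -> L}) i :
  nl_center L (x i) -> nl_center L (bracket x).
Proof. by move=> /bracket_center->; apply: center0. Qed.

Definition center_ideal : ideal L := Ideal center0 centerZD center_bracket.

End CenterIdeal.

(* The free n-Lie algebra on X: formal n-Lie algebra expressions in X modulo   *)
(* the congruence generated by the axioms.                                     *)
Section FreeAlgebra.
Variables (F : fieldType) (n : nat) (X : Type).

Inductive expr :=
| EVar of X
| EZero
| EAdd of expr & expr
| EOpp of expr
| EScale of F & expr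
| EBracket of ('I_n -> expr).

HB.instance Definition _ := gen_eqMixin expr.
HB.instance Definition _ := gen_choiceMixin expr.

Definition eupd (x : 'I_n -> expr) (i : 'I_n) (u : expr) : 'I_n -> expr :=
  fun j => if j == i then u else x j.

Inductive expr_eq : expr -> expr -> Prop :=
| ee_refl e : expr_eq e e
| ee_sym e f : expr_eq e f -> expr_eq f e
| ee_trans e f g : expr_eq e f -> expr_eq f g -> expr_eq e g
| ee_addc e e' f f' :
    expr_eq e e' -> expr_eq f f' -> expr_eq (EAdd e f) (EAdd e' f')
| ee_oppc e e' : expr_eq e e' -> expr_eq (EOpp e) (EOpp e')
| ee_scalec a e e' : expr_eq e e' -> expr_eq (EScale a e) (EScale a e')
| ee_bracketc x y :
    (forall i, expr_eq (x i) (y i)) -> expr_eq (EBracket x) (EBracket y)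
| ee_addA e f g : expr_eq (EAdd e (EAdd f g)) (EAdd (EAdd e f) g)
| ee_addC e f : expr_eq (EAdd e f) (EAdd f e)
| ee_add0 e : expr_eq (EAdd EZero e) e
| ee_addN e : expr_eq (EAdd (EOpp e) e) EZero
| ee_scaleA a b e : expr_eq (EScale a (EScale b e)) (EScale (a * b) e)
| ee_scale1 e : expr_eq (EScale 1 e) e
| ee_scaleDr a e f :
    expr_eq (EScale a (EAdd e f)) (EAdd (EScale a e) (EScale a f))
| ee_scaleDl a b e :
    expr_eq (EScale (a + b) e) (EAdd (EScale a e) (EScale b e))
| ee_linear x i a u v :
    expr_eq (EBracket (eupd x i (EAdd (EScale a u) v)))
      (EAdd (EScale a (EBracket (eupd x i u))) (EBracket (eupd x i v)))
| ee_alt x i j : i != j -> expr_eq (x i) (x j) -> expr_eq (EBracket x) EZero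
| ee_filippov x y (l : 'I_n) : l.+1 = n :> nat ->
    expr_eq (EBracket (eupd x l (EBracket y)))
      (\big[EAdd/EZero]_(i < n)
         EBracket (eupd y i (EBracket (eupd x l (y i))))).

Definition expr_equiv : rel expr := fun e f => `[< expr_eq e f >].

Fact expr_equiv_refl : reflexive expr_equiv.
Proof. by move=> e; apply/asboolP/ee_refl. Qed.
Fact expr_equiv_sym : symmetric expr_equiv.
Proof. by move=> e f; apply/asboolP/asboolP; apply: ee_sym. Qed.
Fact expr_equiv_trans : transitive expr_equiv.
Proof. by move=> f e g /asboolP ef /asboolP fg; apply/asboolP/(ee_trans ef fg). Qed.

Canonical expr_equivR :=
  EquivRel expr_equiv expr_equiv_refl expr_equiv_sym expr_equiv_trans.

Definition freealg := {eq_quot expr_equiv}.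
HB.instance Definition _ := Choice.on freealg.
HB.instance Definition _ := EqQuotient.on freealg.

Definition fr_pi (e : expr) : freealg := \pi_freealg e.

Lemma fr_piP e f : fr_pi e = fr_pi f <-> expr_eq e f.
Proof.
have E : reflect (fr_pi e = fr_pi f) (expr_equiv e f) by apply: eqquotP.
by split=> [/E/asboolP|/asboolP/E].
Qed.

Lemma fr_reprK (p : freealg) : fr_pi (repr p) = p.
Proof. exact: reprK. Qed.

Lemma fr_repr e : expr_eq (repr (fr_pi e)) e.
Proof. by apply/fr_piP; rewrite fr_reprK. Qed.

Lemma fr_ind (K : freealg -> Prop) : (forall u, K (fr_pi u)) -> forall p, K p.
Proof. by move=> H p; rewrite -[p]fr_reprK. Qed.

Definition fr_add (p q : freealg) : freealg := fr_pi (EAdd (repr p) (repr q)).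
Definition fr_opp (p : freealg) : freealg := fr_pi (EOpp (repr p)).
Definition fr_scale (a : F) (p : freealg) : freealg := fr_pi (EScale a (repr p)).
Definition fr_bracket (x : {ffun 'I_n -> freealg}) : freealg :=
  fr_pi (EBracket (fun i => repr (x i))).

Lemma fr_addE e f : fr_add (fr_pi e) (fr_pi f) = fr_pi (EAdd e f).
Proof. by apply/fr_piP/ee_addc; apply: fr_repr. Qed.
Lemma fr_oppE e : fr_opp (fr_pi e) = fr_pi (EOpp e).
Proof. by apply/fr_piP/ee_oppc; apply: fr_repr. Qed.
Lemma fr_scaleE a e : fr_scale a (fr_pi e) = fr_pi (EScale a e).
Proof. by apply/fr_piP/ee_scalec; apply: fr_repr. Qed.
Lemma fr_bracketE (x : 'I_n -> expr) :
  fr_bracket [ffun i => fr_pi (x i)] = fr_pi (EBracket x).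
Proof. by apply/fr_piP/ee_bracketc => i; rewrite ffunE; apply: fr_repr. Qed.

Fact fr_addA : associative fr_add.
Proof. by do 3!elim/fr_ind=> ?; rewrite !fr_addE; apply/fr_piP/ee_addA. Qed.
Fact fr_addC : commutative fr_add.
Proof. by do 2!elim/fr_ind=> ?; rewrite !fr_addE; apply/fr_piP/ee_addC. Qed.
Fact fr_add0 : left_id (fr_pi EZero) fr_add.
Proof. by elim/fr_ind=> ?; rewrite fr_addE; apply/fr_piP/ee_add0. Qed.
Fact fr_addN : left_inverse (fr_pi EZero) fr_opp fr_add.
Proof. by elim/fr_ind=> ?; rewrite fr_oppE fr_addE; apply/fr_piP/ee_addN. Qed.

HB.instance Definition _ :=
  GRing.isZmodule.Build freealg fr_addA fr_addC fr_add0 fr_addN.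

Lemma fr_piD e f : fr_pi (EAdd e f) = fr_pi e + fr_pi f.
Proof. by rewrite -fr_addE. Qed.

Fact fr_scaleA a b p : fr_scale a (fr_scale b p) = fr_scale (a * b) p.
Proof. by elim/fr_ind: p => ?; rewrite !fr_scaleE; apply/fr_piP/ee_scaleA. Qed.
Fact fr_scale1 : left_id 1 fr_scale.
Proof. by elim/fr_ind=> ?; rewrite fr_scaleE; apply/fr_piP/ee_scale1. Qed.
Fact fr_scaleDr : right_distributive fr_scale +%R.
Proof.
move=> a; do 2!elim/fr_ind=> ?; rewrite -fr_piD !fr_scaleE -fr_piD.
by apply/fr_piP/ee_scaleDr.
Qed.
Fact fr_scaleDl p : {morph fr_scale^~ p : a b / a + b}.
Proof.
elim/fr_ind: p => ? a b /=; rewrite !fr_scaleE -fr_piD.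
by apply/fr_piP/ee_scaleDl.
Qed.

HB.instance Definition _ := GRing.Zmodule_isLmodule.Build F freealg
  fr_scaleA fr_scale1 fr_scaleDr fr_scaleDl.

Lemma fr_piZ a e : fr_pi (EScale a e) = a *: fr_pi e.
Proof. by rewrite -fr_scaleE. Qed.

Lemma fr_ffunP (x : {ffun 'I_n -> freealg}) :
  exists y : 'I_n -> expr, x = [ffun i => fr_pi (y i)].
Proof.
by exists (fun j => repr (x j)); apply/ffunP => i; rewrite !ffunE fr_reprK.
Qed.

Lemma fr_upd (x : 'I_n -> expr) i u :
  upd [ffun j => fr_pi (x j)] i (fr_pi u) = [ffun j => fr_pi (eupd x i u j)].
Proof. by apply/ffunP => j; rewrite !ffunE /eupd; case: eqP. Qed.

Fact fr_bracket_linear (x : {ffun 'I_n -> freealg}) i (a : F) (u v : freealg) :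
  fr_bracket (upd x i (a *: u + v)) =
    a *: fr_bracket (upd x i u) + fr_bracket (upd x i v).
Proof.
have [{}x ->] := fr_ffunP x.
elim/fr_ind: u => u; elim/fr_ind: v => v.
rewrite -fr_piZ -fr_piD !fr_upd !fr_bracketE -fr_piZ -fr_piD.
by apply/fr_piP/ee_linear.
Qed.

Fact fr_bracket_alt (x : {ffun 'I_n -> freealg}) i j :
  i != j -> x i = x j -> fr_bracket x = 0.
Proof.
move=> ij xij; apply/fr_piP; apply: ee_alt ij _.
by rewrite xij; apply: ee_refl.
Qed.

Fact fr_bracket_filippov (x y : {ffun 'I_n -> freealg}) (l : 'I_n) :
  l.+1 = n :> nat ->
  fr_bracket (upd x l (fr_bracket y))
    = \sum_(i < n) fr_bracket (upd y i (fr_bracket (upd x l (y i)))).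
Proof.
move=> ln; have [[{}x ->] [{}y ->]] := (fr_ffunP x, fr_ffunP y).
rewrite fr_bracketE fr_upd fr_bracketE.
transitivity (fr_pi (\big[EAdd/EZero]_(i < n)
         EBracket (eupd y i (EBracket (eupd x l (y i)))))).
  exact/fr_piP/ee_filippov.
rewrite (big_morph fr_pi fr_piD (erefl : fr_pi EZero = 0)).
by apply: eq_bigr => i _; rewrite ffunE !(fr_upd, fr_bracketE).
Qed.

HB.instance Definition _ := Lmodule_isNLie.Build F n freealg
  fr_bracket_linear fr_bracket_alt fr_bracket_filippov.

Definition fr_var (s : X) : freealg := fr_pi (EVar s).

Section Universal.
Variables (M : nLieType F n) (g : X -> M).

Fixpoint eeval (e : expr) : M :=
  match e with
  | EVar s => g s
  | EZero => 0
  | EAdd e f => eeval e + eeval f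
  | EOpp e => - eeval e
  | EScale a e => a *: eeval e
  | EBracket x => bracket [ffun i => eeval (x i)]
  end.

Lemma eeval_upd x i u :
  [ffun j => eeval (eupd x i u j)] = upd [ffun j => eeval (x j)] i (eeval u).
Proof. by apply/ffunP => j; rewrite !ffunE /eupd; case: eqP. Qed.

Lemma eeval_eq e f : expr_eq e f -> eeval e = eeval f.
Proof.
elim=> //=.
- by move=> e1 e2 e3 _ -> _ ->.
- by move=> ? ? ? ? _ -> _ ->.
- by move=> ? ? _ ->.
- by move=> ? ? ? _ ->.
- by move=> x y _ xy; congr bracket; apply/ffunP => i; rewrite !ffunE.
- by move=> *; rewrite addrA.
- by move=> *; rewrite addrC.
- by move=> *; rewrite add0r.
- by move=> *; rewrite addNr.
- by move=> *; rewrite scalerA.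
- by move=> *; rewrite scale1r.
- by move=> *; rewrite scalerDr.
- by move=> *; rewrite scalerDl.
- by move=> x i a u v; rewrite !eeval_upd /= bracket_linear.
- by move=> x i j ij _ xij; apply: (bracket_alt _ _ _ ij); rewrite !ffunE.
- move=> x y l ln.
  rewrite (big_morph eeval (fun _ _ => erefl) (erefl : eeval EZero = 0)).
  rewrite eeval_upd bracket_filippov //; apply: eq_bigr => i _ /=.
  by rewrite ffunE !eeval_upd /= !eeval_upd.
Qed.

Definition fr_eval (p : freealg) : M := eeval (repr p).

Lemma fr_evalE e : fr_eval (fr_pi e) = eeval e.
Proof. exact/eeval_eq/fr_repr. Qed.

Fact fr_eval_linear : linear fr_eval.
Proof.
move=> a; do 2!elim/fr_ind=> ?.
by rewrite -fr_piZ -fr_piD !fr_evalE.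
Qed.

HB.instance Definition _ :=
  GRing.isLinear.Build F freealg M *:%R fr_eval fr_eval_linear.

Fact fr_eval_hom : is_hom fr_eval.
Proof.
move=> x; have [{}x ->] := fr_ffunP x.
rewrite -[X in fr_eval X]/(fr_bracket _) fr_bracketE fr_evalE /=.
by congr bracket; apply/ffunP => i; rewrite !ffunE fr_evalE.
Qed.

Lemma fr_eval_unique (f : {linear freealg -> M}) :
  is_hom f -> (forall s, f (fr_var s) = g s) -> f =1 fr_eval.
Proof.
move=> fh fg; elim/fr_ind=> e; rewrite fr_evalE; elim: e => /=.
- exact: fg.
- exact: linear0.
- by move=> e IHe e' IHe'; rewrite fr_piD linearD IHe IHe'.
- by move=> e IHe; rewrite -fr_oppE linearN IHe.
- by move=> a e IHe; rewrite fr_piZ linearZ IHe.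
- move=> x IHx; rewrite -fr_bracketE fh; congr bracket.
  by apply/ffunP => i; rewrite !ffunE.
Qed.

End Universal.

Lemma freealg_free : is_free_on fr_var.
Proof.
move=> M g; exists (fr_eval g); split; first exact: fr_eval_hom.
  by move=> s; rewrite /= /fr_var fr_evalE.
by move=> f; apply: fr_eval_unique.
Qed.

End FreeAlgebra.

Lemma free_presentation_exists (F : fieldType) (n : nat) (L : nLieType F n) :
  inhabited (free_presentation L).
Proof.
pose f : {linear freealg F n L -> L} := fr_eval (@id L).
split; apply: (@FreePresentation _ _ _ _ f).
- by exists L, (@fr_var F n L); apply: freealg_free.
- exact: fr_eval_hom.
- by move=> y; exists (fr_var F n y); rewrite /= /fr_var fr_evalE.
Qed.

(* Main.v *)
(* Let F -> L be a free presentation with kernel R, and let S be the kernel of *)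
(* F -> L / Z(L). A non-abelian filiform L of dimension m has Z(L) = L^{m-n+1}, *)
(* a line contained in L^2, so S = <s> + R with s in F^2. The quotient of       *)
(* S & F^2 by [R, F, ..., F] has dimension dim M(L) + 1, computed through       *)
(* R & F^2, and dim M(L / Z(L)) + k, computed through [S, F, ..., F], where     *)
(* k = dim [S, F, ..., F] / [R, F, ..., F]. As [s, F^2, F, ..., F] lies in      *)
(* [R, F, ..., F] and L / L^2 has dimension n, alternation leaves only the n    *)
(* brackets of s with n - 1 of n generators, so 0 <= k <= n and t = k - 1.      *)
(* In the abelian case m = n, M(L) is spanned by one bracket and L / Z(L) = 0.  *)
Require Import Defs.
From mathcomp Require Import all_boot all_order all_fingroup all_algebra zify.
From mathcomp Require Import boolp classical_sets.

Set Implicit Arguments.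
Unset Strict Implicit.
Unset Printing Implicit Defensive.

Import Order.TTheory GRing.Theory Num.Theory.
Local Open Scope ring_scope.

(** Both multipliers are read off inside one free algebra. By [multiplier_dimP] a single
    presentation of L determines dim M(L), and [quot_center_presentation] keeps the same free
    algebra for L / Z(L). By [fp_lcs2_finite], F^2 is finite-dimensional modulo [R, F, ..., F], so
    dimensions of the factors exist and add along chains ([dim_mod_ex], [dim_mod_add]).

    Two facts about L enter the count. [filiform_center] makes Z(L) a line inside L^2 when m > n.
    [fp_center_brackets_span] bounds [S, F, ..., F] modulo [R, F, ..., F] by n: the Filippov
    identity kills a bracket of s with an element of F^2 ([fp_center_bracket]), and alternation
    leaves only the choice of the omitted generator ([bracket_lift_span]). [multiplier_dim_filiform]
    compares the two chains, and [multiplier_dim_abelian] settles m = n. *)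

Section LinearSets.
Local Open Scope classical_set_scope.
Variables (F : fieldType) (V : lmodType F).
Implicit Types A B C S T : set V.

(** * Linear algebra modulo a subspace *)

Definition subspace A : Prop :=
  A 0 /\ forall a u v, A u -> A v -> A (a *: u + v).

Lemma subspaceD A u v : subspace A -> A u -> A v -> A (u + v).
Proof. by case=> _ AZD Au Av; rewrite -[u]scale1r; apply: AZD. Qed.

Lemma subspaceZ A a u : subspace A -> A u -> A (a *: u).
Proof. by case=> A0 AZD Au; rewrite -[_ *: _]addr0; apply: AZD. Qed.

Lemma subspaceN A u : subspace A -> A u -> A (- u).
Proof. by move=> sA Au; rewrite -scaleN1r; apply: subspaceZ. Qed.

Lemma subspaceB A u v : subspace A -> A u -> A v -> A (u - v).
Proof. by move=> sA Au Av; apply: subspaceD => //; apply: subspaceN. Qed.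

Lemma subspace_sum A (I : finType) (u : I -> V) :
  subspace A -> (forall i, A (u i)) -> A (\sum_i u i).
Proof.
move=> sA Au; apply: (big_ind A) => //; first by case: sA.
by move=> ? ?; apply: subspaceD.
Qed.

Lemma subspace_set0 : subspace [set 0 : V].
Proof. by split=> // a u v -> ->; rewrite scaler0 addr0. Qed.

Lemma subspaceI A B : subspace A -> subspace B -> subspace (A `&` B).
Proof.
move=> [A0 AZD] [B0 BZD]; split=> // a u v [Au Bu] [Av Bv].
by split; [apply: AZD | apply: BZD].
Qed.

Lemma sub_lspan S : S `<=` lspan S.
Proof.
move=> v Sv; exists 1%N, (fun=> 1), (fun=> v); split=> //.
by rewrite big_ord1 scale1r.
Qed.

Lemma lspan_subspace S : subspace (lspan S).
Proof.
split=> [|a _ _ [k [c [b [Sb ->]]]] [l [c' [b' [Sb' ->]]]]].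
  by exists 0%N, (fun=> 0), (fun=> 0); split=> [[]|]; rewrite ?big_ord0.
exists (k + l)%N, (fun i => match split i with inl j => a * c j | inr j => c' j end),
  (fun i => match split i with inl j => b j | inr j => b' j end).
split=> [i|]; first by case: splitP.
rewrite big_split_ord scaler_sumr; congr (_ + _); apply: eq_bigr => i _.
  by rewrite (unsplitK (inl _ i)) scalerA.
by rewrite (unsplitK (inr _ i)).
Qed.

Lemma lspan_min S T : subspace T -> S `<=` T -> lspan S `<=` T.
Proof.
move=> sT ST _ [k [c [b [Sb ->]]]]; apply: subspace_sum => // i.
by apply: subspaceZ => //; apply: ST.
Qed.

Lemma lspan_mono S T : S `<=` T -> lspan S `<=` lspan T.
Proof.
by move=> ST; apply: lspan_min (lspan_subspace T) _ => v /ST; apply: sub_lspan.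
Qed.

(** The sum of [B] and the span of the [g i], in the form of the spanning clause of [dim_mod]. *)
Definition span_mod k (g : 'I_k -> V) B : set V :=
  [set v | exists c : 'I_k -> F, B (v - \sum_(i < k) c i *: g i)].

Lemma span_mod_subspace k (g : 'I_k -> V) B :
  subspace B -> subspace (span_mod g B).
Proof.
move=> sB; split=> [|a u v [c Bc] [c' Bc']].
  exists (fun=> 0); rewrite big1 ?subr0; first by case: sB.
  by move=> i _; rewrite scale0r.
exists (fun i => a * c i + c' i).
have -> : \sum_(i < k) (a * c i + c' i) *: g i =
    a *: (\sum_(i < k) c i *: g i) + \sum_(i < k) c' i *: g i.
  by rewrite scaler_sumr -big_split; apply: eq_bigr => i _; rewrite scalerDl scalerA.
by rewrite opprD addrACA -scalerBr; case: sB => _; apply.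
Qed.

Lemma sub_span_mod k (g : 'I_k -> V) B : B `<=` span_mod g B.
Proof.
move=> v Bv; exists (fun=> 0); rewrite big1 ?subr0 // => i _.
by rewrite scale0r.
Qed.

Lemma span_mod_gen k (g : 'I_k -> V) B i : subspace B -> span_mod g B (g i).
Proof.
move=> sB; exists (fun j => (j == i)%:R); rewrite (bigD1 i) //= eqxx scale1r.
rewrite big1 ?addr0 ?subrr => [|j /negbTE->]; last by rewrite scale0r.
by case: sB.
Qed.

Lemma span_mod_min k (g : 'I_k -> V) B T :
  subspace T -> (forall i, T (g i)) -> B `<=` T -> span_mod g B `<=` T.
Proof.
move=> sT Tg BT v [c /BT Tv]; rewrite -(subrK (\sum_i c i *: g i) v).
apply: subspaceD => //; apply: subspace_sum => // i.
exact: subspaceZ.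
Qed.

(** Steinitz bound: for [d > k] the d x k matrix of coefficients has a nonzero left kernel vector,
    which is a relation among the [b i] modulo [B]. *)
Lemma indep_mod_leq B d k (b : 'I_d -> V) (g : 'I_k -> V) : subspace B ->
    (forall i, span_mod g B (b i)) ->
    (forall c : 'I_d -> F, B (\sum_(i < d) c i *: b i) -> forall i, c i = 0) ->
  (d <= k)%N.
Proof.
move=> sB /choice[M BM] indep; rewrite leqNgt; apply/negP => ltkd.
pose A := \matrix_(i, j) M i j.
have : kermx A != 0.
  by rewrite kermx_eq0 /row_free neq_ltn (leq_ltn_trans (rank_leq_col A)).
case/rowV0Pn=> u /sub_kermxP uA; apply/negP; rewrite negbK.
apply/eqP/rowP => i; rewrite mxE; apply: (indep (fun i => u 0 i)) => {i}.
(* The equation u A = 0 cancels the [g j], leaving a combination of elements of [B]. *)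
have -> : \sum_(i < d) u 0 i *: b i =
    \sum_(i < d) u 0 i *: (b i - \sum_(j < k) M i j *: g j).
  apply/eqP; rewrite -subr_eq0 -sumrB; apply/eqP.
  under eq_bigr => i _ do rewrite scalerBr opprB addrC subrK scaler_sumr.
  rewrite exchange_big big1 // => j _ /=.
  under eq_bigr => i _ do rewrite scalerA.
  rewrite -scaler_suml; have /rowP/(_ j) := uA; rewrite !mxE.
  under eq_bigr => i _ do rewrite mxE.
  by move->; rewrite scale0r.
by apply: subspace_sum => // i; apply: subspaceZ.
Qed.

(** By [indep_mod_leq] there is a largest family in [A] independent modulo [B]; by maximality it
    spans. *)
Lemma dim_mod_ex A B k (g : 'I_k -> V) : subspace B -> A `<=` span_mod g B ->
  exists2 d, (d <= k)%N & dim_mod A B d.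
Proof.
move=> sB Ag; pose indep d := `[< exists b : 'I_d -> V, (forall i, A (b i)) /\
  forall c : 'I_d -> F, B (\sum_(i < d) c i *: b i) -> forall i, c i = 0 >].
have indep0 : exists d, indep d by exists 0%N; apply/asboolP; exists (fun=> 0); split=> [[]|? _ []].
have indep_le d : indep d -> (d <= k)%N.
  by case/asboolP=> b [Ab ib]; apply: (indep_mod_leq sB _ ib) => i; apply: Ag.
case: (ex_maxnP indep0 indep_le) => d id dmax; exists d; first exact: indep_le.
case/asboolP: id => b [Ab ib]; exists b; split=> // v Av.
apply: contrapT => nv; suff /dmax : indep d.+1 by rewrite ltnn.
apply/asboolP; exists (fun i => if unlift ord0 i is Some j then b j else v).
split=> [i|c]; first by case: unliftP.
rewrite big_ord_recl unlift_none; under eq_bigr => i _ do rewrite liftK.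
(* A nonzero coefficient of [v] would put [v] in the span of the [b i] modulo [B]. *)
move=> Bc; have c0 : c ord0 = 0.
  apply/eqP; apply: contrapT => /negP c0; apply: nv.
  exists (fun i => - (c ord0)^-1 * c (lift ord0 i)).
  have := subspaceZ (c ord0)^-1 sB Bc; rewrite scalerDr scalerA mulVf // scale1r.
  congr (B (_ + _)); rewrite -sumrN scaler_sumr; apply: eq_bigr => i _.
  by rewrite scalerA mulNr scaleNr opprK.
move: Bc; rewrite c0 scale0r add0r => /ib cl i.
by case: (unliftP ord0 i) => [j ->|->].
Qed.

Lemma dim_mod_unique A B d e :
  subspace B -> dim_mod A B d -> dim_mod A B e -> d = e.
Proof.
move=> sB [b [Ab sb ib]] [b' [Ab' sb' ib']]; apply/eqP; rewrite eqn_leq.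
by apply/andP; split; [apply: (indep_mod_leq sB _ ib)|apply: (indep_mod_leq sB _ ib')];
  move=> i; [apply: sb'|apply: sb].
Qed.

Lemma dim_mod_add A B C d e : subspace B -> C `<=` B -> B `<=` A ->
  dim_mod A B d -> dim_mod B C e -> dim_mod A C (d + e).
Proof.
move=> sB CB BA [b [Ab sb ib]] [b' [Bb' sb' ib']].
pose bb i := match split i with inl j => b j | inr j => b' j end.
have bbE (c : 'I_(d + e) -> F) : \sum_i c i *: bb i =
    \sum_i c (lshift e i) *: b i + \sum_i c (rshift d i) *: b' i.
  rewrite big_split_ord; congr (_ + _); apply: eq_bigr => i _; rewrite /bb.
    by rewrite (unsplitK (inl _ i)).
  by rewrite (unsplitK (inr _ i)).
exists bb; split=> [i|v Av|c].
- by rewrite /bb; case: splitP => j _ //; apply: BA.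
- have [c Bc] := sb v Av; have [c' Cc'] := sb' _ Bc.
  exists (fun i => match split i with inl j => c j | inr j => c' j end).
  rewrite bbE opprD addrA; congr (C (_ - _ - _)) : Cc'; apply: eq_bigr => i _.
    by rewrite (unsplitK (inl _ i)).
  by rewrite (unsplitK (inr _ i)).
rewrite bbE => Cc; have /ib cl : B (\sum_i c (lshift e i) *: b i).
  rewrite -[X in B X](addrK (\sum_i c (rshift d i) *: b' i)).
  apply: subspaceB => //; first exact: CB.
  by apply: subspace_sum => // i; apply: subspaceZ.
have /ib' cr : C (\sum_i c (rshift d i) *: b' i).
  by rewrite big1 ?add0r // in Cc => i _; rewrite cl scale0r.
by move=> i; rewrite -(splitK i); case: split => j /=.
Qed.

Lemma dim_modB A B C a b : subspace B -> subspace C -> C `<=` B -> B `<=` A ->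
  dim_mod A C a -> dim_mod B C b -> dim_mod A B (a - b).
Proof.
move=> sB sC CB BA dA dB; have [g [_ sg _]] := dA.
have [|e _ dAB] := @dim_mod_ex A B a g sB.
  by move=> v /sg[c /CB]; exists c.
have := dim_mod_unique sC dA (dim_mod_add sB CB BA dAB dB) => ->.
by rewrite addnK.
Qed.

Lemma dim_mod_line B v :
  subspace B -> ~ B v -> dim_mod (span_mod (fun _ : 'I_1 => v) B) B 1.
Proof.
move=> sB nBv; exists (fun=> v); split=> // [_|c].
  exact: (span_mod_gen (fun _ : 'I_1 => v) ord0).
rewrite big_ord1 => Bcv i; rewrite ord1; apply/eqP/negPn/negP => c0.
by apply: nBv; rewrite -[v]scale1r -(mulVf c0) -scalerA; apply: subspaceZ.
Qed.

Lemma dim_mod0 A B : A `<=` B -> dim_mod A B 0.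
Proof.
move=> AB; exists (fun=> 0); split=> [[]//|v /AB Bv|c _ []//].
by exists (fun=> 0); rewrite big_ord0 subr0.
Qed.

Lemma dim_mod0_sub A B : dim_mod A B 0 -> A `<=` B.
Proof. by case=> b [_ sb _] v /sb[c]; rewrite big_ord0 subr0. Qed.

End LinearSets.

(** [f] and [g] are inverse to each other only modulo [B] and [B'], as happens for the lifts between
    two presentations. *)
Lemma dim_mod_iso (F : fieldType) (V W : lmodType F) (A B : set V) (A' B' : set W)
    (f : {linear V -> W}) (g : {linear W -> V}) d :
  subspace B -> subspace B' ->
  (forall v, A v -> A' (f v)) -> (forall v, B v -> B' (f v)) ->
  (forall w, A' w -> A (g w)) -> (forall w, B' w -> B (g w)) ->
  (forall v, A v -> B (g (f v) - v)) -> (forall w, A' w -> B' (f (g w) - w)) ->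
  dim_mod A B d -> dim_mod A' B' d.
Proof.
move=> sB sB' fA fB gA gB gfK fgK [b [Ab sb ib]].
exists (f \o b); split=> [i|w A'w|c B'c] /=; first exact: fA.
  have [c /fB B'c] := sb _ (gA _ A'w); exists c.
  have -> : w - \sum_i c i *: f (b i) =
      f (g w - \sum_i c i *: b i) - (f (g w) - w).
    rewrite linearB (linear_sum f) opprB [RHS]addrC addrA subrK.
    by congr (_ - _); apply: eq_bigr => i _; rewrite linearZ.
  by apply: subspaceB => //; apply: fgK.
apply: ib; have -> : \sum_i c i *: b i =
    g (\sum_i c i *: f (b i)) - \sum_i c i *: (g (f (b i)) - b i).
  rewrite (linear_sum g) -sumrB; apply: eq_bigr => i _.
  by rewrite linearZ -scalerBr opprB addrC subrK.
apply: subspaceB => //; first exact: gB.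
by apply: subspace_sum => // i; apply: subspaceZ => //; apply: gfK.
Qed.

(** * Brackets of subspaces and the lower central series *)

Section NLieAlgebra.
Local Open Scope classical_set_scope.
Variables (F : fieldType) (n : nat) (L : nLieType F n).
Implicit Types (x y : {ffun 'I_n -> L}) (A B T : set L).

Lemma bracket_perm x (s : 'S_n) :
  bracket [ffun i => x (s i)] = (-1) ^+ s *: bracket x.
Proof.
have [ts -> dts] := prod_tpermP s; elim: ts dts => [_|[i j] ts IH /= /andP[ij dts]].
  rewrite big_nil odd_perm1 scale1r; congr bracket.
  by apply/ffunP => k; rewrite ffunE perm1.
rewrite big_cons odd_mul_tperm ij signr_addb -scalerA -IH // scaleN1r.
rewrite -(bracket_tperm _ ij); congr bracket.
by apply/ffunP => k; rewrite !ffunE permM.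
Qed.

Lemma subspace_bracket_upd T x i :
  subspace T -> subspace [set u | T (bracket (upd x i u))].
Proof.
move=> [T0 TZD]; split=> [|a u v Tu Tv] /=; last by rewrite bracket_linear; apply: TZD.
by rewrite (@bracket0 _ _ _ _ i) // ffunE eqxx.
Qed.

(** Multilinearity reduces to generators; the induction on [k] frees the positions below [k] from
    [G i] to its span. *)
Lemma bracket_lspan_ind (G : 'I_n -> set L) T : subspace T ->
    (forall x, (forall i, G i (x i)) -> T (bracket x)) ->
  forall x, (forall i, lspan (G i) (x i)) -> T (bracket x).
Proof.
move=> sT TG x Gx.
suff H k : (k <= n)%N -> forall y, (forall i : 'I_n, lspan (G i) (y i)) ->
    (forall i : 'I_n, (k <= i)%N -> G i (y i)) -> T (bracket y).
  by apply: (H n) => // i; rewrite leqNgt ltn_ord.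
elim: k => [_ y _ Gy|k IH kn y Gy Gyk]; first by apply: TG => i; apply: Gy.
pose i := Ordinal kn; rewrite -(upd_id y i).
apply: (lspan_min (subspace_bracket_upd y i sT) _ (Gy i)) => u Gu.
apply: IH (ltnW kn) _ _ _ => j; rewrite ffunE.
  by case: eqP => [->|_]; [apply: sub_lspan|].
case: eqP => [-> //|/eqP ij kj]; apply: Gyk.
by rewrite ltn_neqAle kj andbT; apply: contra ij => /eqP e; apply/eqP/val_inj.
Qed.

Lemma brackets_subspace A : subspace (brackets A).
Proof. exact: lspan_subspace. Qed.

Lemma brackets_mono A B : A `<=` B -> brackets A `<=` brackets B.
Proof.
by move=> AB; apply: lspan_mono => _ [x [Ax ->]]; exists x; split=> // i /Ax/AB.
Qed.

(** [brackets] constrains the first position; a transposition brings position [i] there, up to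
    sign. *)
Lemma brackets_bracket A x i : A (x i) -> brackets A (bracket x).
Proof.
move=> Axi; pose o := Ordinal (leq_ltn_trans (leq0n i) (ltn_ord i)).
rewrite -[bracket x]opprK; have [ei|i0] := eqVneq i o.
  rewrite opprK; apply: sub_lspan; exists x; split=> // j j0.
  by rewrite (_ : j = i) // ei; apply: val_inj.
rewrite -(bracket_tperm x i0); apply: subspaceN (brackets_subspace A) _.
apply: sub_lspan; exists [ffun k => x (tperm i o k)]; split=> // j j0.
by rewrite ffunE (_ : j = o) ?tpermR //; apply: val_inj.
Qed.

Lemma lcs_subspace i : subspace (lcs L i).
Proof. by case: i => [//|[//|i]]; apply: brackets_subspace. Qed.

Lemma lcs_anti i : lcs L i.+1 `<=` lcs L i.
Proof. by case: i => [//|]; elim=> [//|i IH]; apply: brackets_mono. Qed.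

(** Passing from [y] to [x] one entry at a time changes the bracket at each stage by a bracket with
    an entry in [B]. *)
Lemma bracket_sub_brackets B x y :
  (forall i, B (x i - y i)) -> brackets B (bracket x - bracket y).
Proof.
move=> Bxy; pose z k : {ffun 'I_n -> L} := [ffun i : 'I_n => if (i < k)%N then x i else y i].
have <- : z n = x by apply/ffunP => i; rewrite ffunE ltn_ord.
suff H k : (k <= n)%N -> brackets B (bracket (z k) - bracket y) by apply: H.
elim: k => [_|k IH kn].
  have -> : z 0%N = y by apply/ffunP => i; rewrite ffunE ltn0.
  by rewrite subrr; case: (brackets_subspace B).
pose i := Ordinal kn.
have -> : z k.+1 = upd (z k) i (1 *: (x i - y i) + y i).
  apply/ffunP => j; rewrite !ffunE ltnS leq_eqVlt -[j == i]/(j == k :> nat) scale1r subrK.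
  by case: eqP => //= e; congr (x _); apply/val_inj.
have e : upd (z k) i (y i) = z k.
  by rewrite -[RHS](upd_id _ i) [in RHS]ffunE ltnn.
rewrite bracket_linear e scale1r -addrA; apply: subspaceD (brackets_subspace B) _ _.
  by apply: (@brackets_bracket _ _ i); rewrite ffunE eqxx.
exact: IH (ltnW kn).
Qed.

Lemma brackets_sub_center A B z : subspace B -> nl_center L z ->
  A `<=` span_mod (fun _ : 'I_1 => z) B -> brackets A `<=` brackets B.
Proof.
move=> sB zc Az; apply: lspan_min (brackets_subspace B) _ => _ [x [Ax ->]].
have [n0|n0] := posnP n.
  apply: sub_lspan; exists x; split=> // i.
  by have := ltn_ord i; rewrite [X in (_ < X)%N]n0.
pose o := Ordinal n0; have [//|c] := Az (x o); first exact: Ax.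
rewrite big_ord1 => Bx; rewrite -(upd_id x o) -[x o](subrK (c (ord0) *: z)) addrC.
rewrite bracket_linear (@bracket_center _ _ _ _ o) ?ffunE ?eqxx // scaler0 add0r.
by apply: (@brackets_bracket _ _ o); rewrite ffunE eqxx.
Qed.

Lemma pigeonhole_bracket k (g : 'I_k -> L) x (s : 'I_n -> 'I_k) :
  (k < n)%N -> (forall i, x i = g (s i)) -> bracket x = 0.
Proof.
move=> kn xs; have /injectivePn[i [j ij sij]] : ~~ injectiveb s.
  by apply/injectiveP => /leq_card; rewrite !card_ord leqNgt kn.
by apply: bracket_alt ij _; rewrite !xs sij.
Qed.

(** After expansion, an entry in [B] gives an element of [brackets B], an entry [z] gives 0, and
    otherwise fewer than n generators fill n positions, so one repeats. *)
Lemma brackets_sub_generators B k (g : 'I_k -> L) z : subspace B -> nl_center L z ->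
  (k < n)%N -> [set: L] `<=` span_mod g (span_mod (fun _ : 'I_1 => z) B) ->
  brackets [set: L] `<=` brackets B.
Proof.
move=> sB zc kn gT; apply: lspan_min (brackets_subspace B) _ => _ [x [_ ->]].
pose G := [set u | (exists j, u = g j) \/ u = z \/ B u].
apply: (@bracket_lspan_ind (fun=> G) _ (brackets_subspace B)) => [y Gy|i].
  have [[i By]|nB] := pselect (exists i, B (y i)); first exact: brackets_bracket By.
  have [B0 _] := brackets_subspace B.
  have [[i zy]|nz] := pselect (exists i, y i = z).
    by rewrite (@bracket_center _ _ _ _ i) // zy.
  have /choice[s ys] : forall i, exists j, y i = g j.
    by move=> i; case: (Gy i) => // -[zi|Bi]; [case: nz|case: nB]; exists i.
  by rewrite (pigeonhole_bracket kn ys).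
have sG := lspan_subspace G; apply: span_mod_min (gT (x i) I) => // [j|].
  by apply: sub_lspan; left; exists j.
apply: span_mod_min => // [_|u Bu]; first by apply: sub_lspan; right; left.
by apply: sub_lspan; right; right.
Qed.

End NLieAlgebra.

Lemma brackets_hom (F : fieldType) (n : nat) (L M : nLieType F n)
    (f : {linear L -> M}) (A : set L) (B : set M) :
  is_hom f -> (forall x, A x -> B (f x)) ->
  forall x, brackets A x -> brackets B (f x).
Proof.
move=> fh AB; apply: lspan_min => [|_ [x [Ax ->]]].
  have [B0 BZD] := brackets_subspace B; split=> [|a u v Bu Bv]; rewrite ?linear0 ?linearP //.
  exact: BZD.
rewrite fh; apply: sub_lspan; exists [ffun i => f (x i)]; split=> // i i0.
by rewrite ffunE; apply/AB/Ax.
Qed.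

Lemma brackets_hom_surj (F : fieldType) (n : nat) (L M : nLieType F n)
    (f : {linear L -> M}) : is_hom f -> (forall y, exists x, f x = y) ->
  forall y, brackets [set: M] y -> exists2 x, brackets [set: L] x & f x = y.
Proof.
move=> fh /choice[g gK]; have [L0 LZD] := brackets_subspace [set: L].
apply: lspan_min => [|_ [y [_ ->]]].
  split=> [|a _ _ [u Lu <-] [v Lv <-]]; first by exists 0; rewrite ?linear0.
  by exists (a *: u + v); [apply: LZD | rewrite linearP].
exists (bracket [ffun i => g (y i)]).
  by apply: sub_lspan; exists [ffun i => g (y i)].
by rewrite fh; congr bracket; apply/ffunP => i; rewrite !ffunE gK.
Qed.

(** * Free presentations and independence of the multiplier from them *)

Section Presentations.
Local Open Scope classical_set_scope.
Variables (F : fieldType) (n : nat).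
Implicit Types L : nLieType F n.

(** Free algebras are projective: [f] is prescribed on generators through a section of [p], and
    [p \o f] agrees with [h] by uniqueness. *)
Lemma free_lift L (M N : nLieType F n) (p : {linear M -> N}) (h : {linear L -> N}) :
  is_free L -> is_hom p -> is_hom h -> (forall y, exists x, p x = y) ->
  exists2 f : {linear L -> M}, is_hom f & forall x, p (f x) = h x.
Proof.
move=> [X [iota fr]] ph hh /choice[q qK].
have [f [fh fi _]] := fr M (q \o h \o iota).
have [e [_ _ eu]] := fr N (h \o iota).
exists f => // x; rewrite (eu h hh) // -[LHS]/((p \o f) x) (eu (p \o f)) // => [y|s] /=.
  by rewrite fh ph; congr bracket; apply/ffunP => i; rewrite !ffunE.
by rewrite fi /= qK.
Qed.

Lemma fp_rel_subspace L (P : free_presentation L) : subspace (fp_rel P).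
Proof.
split=> [|a u v]; rewrite /fp_rel /=; first by rewrite linear0.
by move=> u0 v0; rewrite linearP u0 v0 scaler0 addr0.
Qed.

Lemma fp_map_lcs2_surj L (P : free_presentation L) y :
  lcs L 2 y -> exists2 x, lcs (fp_alg P) 2 x & fp_map P x = y.
Proof. exact: (brackets_hom_surj (@fp_hom _ _ _ P) (fp_surj P)). Qed.

(** Since [f] induces the identity on L, it moves each entry of a bracket by an element of R. *)
Lemma fp_endo_lcs2 L (P : free_presentation L) (f : {linear fp_alg P -> fp_alg P}) x :
  is_hom f -> (forall y, fp_map P (f y) = fp_map P y) ->
  lcs (fp_alg P) 2 x -> brackets (fp_rel P) (f x - x).
Proof.
move=> fh fP; have [R0 RZD] := brackets_subspace (fp_rel P).
move: x; apply: lspan_min => [|_ [x [_ ->]]].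
  split=> [|a u v Ru Rv] /=; first by rewrite linear0 subrr.
  by rewrite linearP opprD addrACA -scalerBr; apply: RZD.
rewrite fh; apply: bracket_sub_brackets => i.
by rewrite /fp_rel /= ffunE linearB fP subrr.
Qed.

(** Freeness gives maps over L in both directions, and by [fp_endo_lcs2] their composites are the
    identity on F^2 modulo [R, F, ..., F]. *)
Lemma multiplier_dimP L (P : free_presentation L) d :
  dim_mod (fp_rel P `&` lcs (fp_alg P) 2) (brackets (fp_rel P)) d ->
  multiplier_dim L d.
Proof.
move=> dP Q.
have lift (P1 P2 : free_presentation L) :
    exists2 f : {linear fp_alg P1 -> fp_alg P2},
      is_hom f & forall x, fp_map P2 (f x) = fp_map P1 x.
  exact: free_lift (fp_free P1) (@fp_hom _ _ _ P2) (@fp_hom _ _ _ P1) (fp_surj P2).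
have [[f fh fE] [g gh gE]] := (lift P Q, lift Q P).
have relf x : fp_rel P x -> fp_rel Q (f x) by rewrite /fp_rel /= fE.
have relg x : fp_rel Q x -> fp_rel P (g x) by rewrite /fp_rel /= gE.
apply: (dim_mod_iso (f := f) (g := g) _ _ _ _ _ _ _ _ dP);
  try exact: brackets_subspace.
- by move=> v [Rv Lv]; split; [apply: relf | apply: brackets_hom Lv].
- exact: brackets_hom.
- by move=> v [Rv Lv]; split; [apply: relg | apply: brackets_hom Lv].
- exact: brackets_hom.
- move=> v [_]; apply: (fp_endo_lcs2 (f := g \o f)) => [x|y] /=.
    by rewrite fh gh; congr bracket; apply/ffunP => i; rewrite !ffunE.
  by rewrite gE fE.
- move=> v [_]; apply: (fp_endo_lcs2 (f := f \o g)) => [x|y] /=.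
    by rewrite gh fh; congr bracket; apply/ffunP => i; rewrite !ffunE.
  by rewrite fE gE.
Qed.

Lemma fp_span_mod L (P : free_presentation L) (B : set L) k (x : 'I_k -> fp_alg P) :
  [set: L] `<=` span_mod (fp_map P \o x) B ->
  [set: fp_alg P] `<=` span_mod x (fp_map P @^-1` B).
Proof.
move=> Lx v _; have [c Bc] := Lx (fp_map P v) I; exists c => /=.
rewrite linearB (linear_sum (fp_map P)); congr (B (_ - _)): Bc.
by apply: eq_bigr => i _; rewrite linearZ.
Qed.

(** Lifts [x] of a basis of L span F modulo R, so multilinearity leaves only brackets of lifts and
    brackets with an entry in R. *)
Lemma fp_lcs2_generators L (P : free_presentation L) m : has_dim [set: L] m ->
  exists x : 'I_m -> fp_alg P, forall T, subspace T -> brackets (fp_rel P) `<=` T ->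
    (forall s : {ffun 'I_n -> 'I_m}, T (bracket [ffun i => x (s i)])) ->
  lcs (fp_alg P) 2 `<=` T.
Proof.
move=> [b [_ sb _]]; have /choice[x xb] := fun i => fp_surj P (b i).
exists x => T sT RT xT; apply: lspan_min => // _ [y [_ ->]].
pose G := [set u | (exists j, u = x j) \/ fp_rel P u].
apply: (@bracket_lspan_ind _ _ _ (fun=> G) _ sT) => [{}y Gy|i].
  have [[i Ry]|nR] := pselect (exists i, fp_rel P (y i)).
    by apply: RT; apply: brackets_bracket Ry.
  have /choice[s ys] : forall i, exists j, y i = x j.
    by move=> i; case: (Gy i) => // Ri; case: nR; exists i.
  have -> : y = [ffun i => x ([ffun k => s k] i)] by apply/ffunP => i; rewrite !ffunE.
  exact: xT.
have /(_ (y i) I) : [set: fp_alg P] `<=` span_mod x (fp_map P @^-1` [set 0]).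
  apply: fp_span_mod => v Lv; have [c] := sb v Lv; exists c => /=.
  by under eq_bigr => j _ do rewrite /= xb.
apply: span_mod_min (lspan_subspace G) _ _ _ => [j|u Ru]; apply: sub_lspan.
  by left; exists j.
by right.
Qed.

Lemma fp_lcs2_finite L (P : free_presentation L) m : has_dim [set: L] m ->
  exists N (g : 'I_N -> fp_alg P),
    lcs (fp_alg P) 2 `<=` span_mod g (brackets (fp_rel P)).
Proof.
move=> /(fp_lcs2_generators P)[x xT]; have sR := brackets_subspace (fp_rel P).
exists _, (fun i : 'I_#|{ffun 'I_n -> 'I_m}| => bracket [ffun j => x (enum_val i j)]).
apply: xT => [||s]; [exact: span_mod_subspace | exact: sub_span_mod |].
by rewrite -[s]enum_rankK; apply: (span_mod_gen _ (enum_rank s)).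
Qed.

End Presentations.

(** * Brackets with a lifted central element, and the center of a filiform algebra *)

Section Counting.
Local Open Scope classical_set_scope.
Variables (F : fieldType) (n : nat).
Implicit Types L : nLieType F n.

Lemma bracket_reindex L (T : set L) (x : {ffun 'I_n -> L}) (s : 'I_n -> 'I_n) :
  subspace T -> T (bracket x) -> T (bracket [ffun i => x (s i)]).
Proof.
move=> sT Tx; have [inj|/injectivePn[i [j ij sij]]] := boolP (injectiveb s).
  have -> : [ffun i => x (s i)] = [ffun i => x (perm (injectiveP _ inj) i)].
    by apply/ffunP => i; rewrite !ffunE permE.
  by rewrite bracket_perm; apply: subspaceZ.
rewrite (bracket_alt _ _ _ ij) ?ffunE ?sij //.
by case: sT.
Qed.

(** The n values of [s] miss some [j], which is not [ord0] since that value is attained; the bracket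
    is then 0 or, up to sign, the one omitting [x j]. *)
Lemma bracket_lift_span L (T : set L) (x : 'I_n.+1 -> L) (s : 'I_n -> 'I_n.+1) i0 :
    subspace T -> s i0 = ord0 ->
    (forall j, j != ord0 -> T (bracket [ffun i => x (lift j i)])) ->
  T (bracket [ffun i => x (s i)]).
Proof.
move=> sT s0 Tx; have [j sj] : exists j, forall i, s i != j.
  apply: contrapT => ns; have /choice[r rK] : forall j, exists i, s i = j.
    move=> j; apply: contrapT => nj; apply: ns; exists j => i.
    by apply/eqP => e; apply: nj; exists i.
  by have := leq_card _ (can_inj rK); rewrite !card_ord ltnn.
have /choice[s' sE] i : exists k, s i = lift j k.
  by case: (unliftP j (s i)) (sj i) => [k ->|->]; [exists k | rewrite eqxx].
have -> : [ffun i => x (s i)] =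
    [ffun i => [ffun k => x (lift j k)] (s' i)].
  by apply/ffunP => i; rewrite !ffunE sE.
by apply: bracket_reindex => //; apply: Tx; rewrite -s0 eq_sym.
Qed.

(* By the Filippov identity, every term of the expansion of [bracket y] has an *)
(* entry that is a bracket involving [y j], hence lies in [R].                 *)
Lemma fp_center_bracket L (P : free_presentation L) (y : {ffun 'I_n -> fp_alg P})
    (i j : 'I_n) (w : {ffun 'I_n -> fp_alg P}) :
  i != j -> nl_center L (fp_map P (y j)) -> y i = bracket w ->
  brackets (fp_rel P) (bracket y).
Proof.
have sR := brackets_subspace (fp_rel P).
have n0 : (0 < n)%N by apply: leq_ltn_trans (ltn_ord i).
have ln : (n.-1 < n)%N by rewrite prednK.
pose l := Ordinal ln.
have H (x : {ffun 'I_n -> fp_alg P}) k : k != l -> nl_center L (fp_map P (x k)) ->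
    x l = bracket w -> brackets (fp_rel P) (bracket x).
  move=> kl xk xl; rewrite -(upd_id x l) xl bracket_filippov ?prednK //.
  apply: subspace_sum => // a; apply: (@brackets_bracket _ _ _ _ _ a).
  rewrite ffunE eqxx /fp_rel /= (@fp_hom _ _ _ P).
  by apply: (@bracket_center _ _ _ _ k); rewrite !ffunE (negbTE kl).
move=> ij yj yi; have [il|il] := eqVneq i l; first by apply: (H y j); rewrite -?il // eq_sym.
(* A transposition moves the entry [bracket w] to the last position, where the Filippov identity
   applies. *)
rewrite -[bracket y]opprK -(bracket_tperm _ il); apply: subspaceN => //.
apply: (H _ (tperm i l j)); rewrite ?ffunE ?tpermK ?tpermR //.
by rewrite -[X in _ != X](tpermL i l) (inj_eq perm_inj) eq_sym.
Qed.

(** Modulo [R, F, ..., F] the first entry reduces to [s] and the others to some [x j] or to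
    brackets; the latter contribute nothing by [fp_center_bracket]. *)
Lemma fp_center_brackets_span L (P : free_presentation L) (s : fp_alg P)
    (x : 'I_n -> fp_alg P) : (0 < n)%N ->
  nl_center L (fp_map P s) ->
  fp_map P @^-1` nl_center L `<=` span_mod (fun _ : 'I_1 => s) (fp_rel P) ->
  [set: fp_alg P] `<=` span_mod x (fp_map P @^-1` lcs L 2) ->
  exists g : 'I_n -> fp_alg P,
    brackets (fp_map P @^-1` nl_center L) `<=` span_mod g (brackets (fp_rel P)).
Proof.
move=> n0 Zs Ss Fx; have sR := brackets_subspace (fp_rel P).
(* [z] lists [s] and then the n elements [x j]; [g j] is the bracket of all of these but [x j]. *)
pose z k := if unlift ord0 k is Some j then x j else s.
pose g j := bracket [ffun i => z (lift (lift ord0 j) i)].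
exists g; have sT := span_mod_subspace g sR.
apply: lspan_min => // _ [y [Sy ->]].
pose G (i : 'I_n) := [set u | fp_rel P u \/
  if i == 0%N :> nat then u = s else
  (exists j, u = x j) \/ exists w, u = bracket w].
apply: (@bracket_lspan_ind _ _ _ G _ sT) => [{Sy}y Gy|i].
  have [[i Ry]|nR] := pselect (exists i, fp_rel P (y i)).
    by apply: sub_span_mod; apply: brackets_bracket Ry.
  pose o := Ordinal n0; have yo : y o = s.
    by case: (Gy o) => //= Ro; case: nR; exists o.
  have [[i [i0 [w yi]]]|nw] := pselect (exists i, i != o /\ exists w, y i = bracket w).
    by apply/sub_span_mod/(fp_center_bracket i0 _ yi); rewrite yo.
  have /choice[f fE] : forall i, exists k, y i = z k /\ (i = o -> k = ord0).
    move=> i; have [->|i0] := eqVneq i o.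
      by exists ord0; rewrite /z unlift_none.
    have [Ri|] := Gy i; first by case: nR; exists i.
    have -> : (i == 0%N :> nat) = false by apply: contraNF i0 => /eqP e; apply/eqP/val_inj.
    case=> [[j yj]|yw]; last by case: nw; exists i.
    by exists (lift ord0 j); rewrite /z liftK; split=> // e; rewrite e eqxx in i0.
  have -> : y = [ffun i => z (f i)].
    by apply/ffunP => i; rewrite ffunE; case: (fE i).
  apply: (@bracket_lift_span _ _ _ _ o) => // [|j]; first by apply: (fE o).2.
  by case: (unliftP ord0 j) => [k -> _|-> /eqP//]; apply: span_mod_gen.
have sG := lspan_subspace (G i).
have RG : fp_rel P `<=` lspan (G i) by move=> u Ru; apply: sub_lspan; left.
have [i0|i0] := eqVneq (i : nat) 0%N.
  apply: span_mod_min sG _ RG _ (Ss _ (Sy i i0)) => _.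
  by apply: sub_lspan; right; rewrite i0.
have FG : lcs (fp_alg P) 2 `<=` lspan (G i).
  apply: lspan_min => // _ [w [_ ->]]; apply: sub_lspan; right.
  by rewrite (negbTE i0); right; exists w.
(* An element lying over L^2 differs from some [v] in F^2 by an element of R. *)
apply: (span_mod_min sG _ _ (Fx (y i) I)) => [j|u /= /(@fp_map_lcs2_surj _ _ _ P)[v Fv uv]].
  by apply: sub_lspan; right; rewrite (negbTE i0); left; exists j.
rewrite -(subrK v u); apply: subspaceD (FG _ Fv) => //.
by apply: RG; rewrite /fp_rel /= linearB uv subrr.
Qed.

(* A central element outside [lcs L i.+1] would make the lower central series  *)
(* stop decreasing at step [i.+1].                                             *)
Lemma filiform_center L m : (0 < n)%N -> has_dim [set: L] m -> (n < m)%N ->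
  (forall i : nat, (2 <= i <= m - n + 2)%N -> has_dim (lcs L i) (m - n + 2 - i)) ->
  nl_center L = lcs L (m - n).+1.
Proof.
move=> n0 dm nm dL; have s0 := @subspace_set0 F L.
have subl i := @lcs_subspace F n L i.
have lcs0 i : [set 0] `<=` lcs L i by move=> _ ->; case: (subl i).
apply/seteqP; split=> [|z Lz x i _ xi]; last first.
  have : lcs L (m - n + 2) (bracket x).
    by rewrite addn2; apply: (@brackets_bracket _ _ _ _ _ i); rewrite xi.
  have := dL (m - n + 2)%N; rewrite leq_addl leqnn => /(_ isT); rewrite subnn.
  by move/dim_mod0_sub; apply.
suff H i : (i <= m - n)%N -> nl_center L `<=` lcs L i.+1 by apply: H.
elim: i => [//|i IH lei] z Zz; apply: contrapT => nLz.
set W := span_mod (fun _ : 'I_1 => z) (lcs L i.+2).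
have dW : dim_mod W (lcs L i.+2) 1 by apply: dim_mod_line.
have sW : subspace W by apply: span_mod_subspace.
have LW : lcs L i.+2 `<=` W by apply: sub_span_mod.
have WL : W `<=` lcs L i.+1.
  apply: span_mod_min => // [_|]; last exact: lcs_anti.
  by apply: IH => //; apply: ltnW.
have dLS j : (j.+1 <= m - n)%N -> has_dim (lcs L j.+2) (m - n - j).
  move=> lej; have := dL j.+2; rewrite addn2 !ltnS subSS subSS; apply.
  exact: ltnW.
have d2 := dLS i lei.
have stop : lcs L i.+2 `<=` lcs L i.+3.
  (* For [i = 0], L / L^2 has dimension n, so n - 1 elements generate L modulo [W]; for larger [i],
     L^{i+1} / L^{i+2} is a line, so [W] is all of L^{i+1}. *)
  case: i IH lei nLz @W dW sW LW WL d2 => [|i] IH lei nLz W dW sW LW WL d2.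
    have d1 : dim_mod [set: L] (lcs L 2) n.
      by have := dim_modB (subl 2) s0 (lcs0 _) (fun _ _ => I) dm d2; rewrite subn0 subKn // ltnW.
    have [g [_ gT _]] := dim_modB sW (subl 2) LW (fun _ _ => I) d1 dW.
    apply: brackets_sub_generators Zz _ gT => //.
    by rewrite subn1 prednK.
  have d1 : dim_mod (lcs L i.+2) (lcs L i.+3) 1.
    have <- : (m - n - i - (m - n - i.+1) = 1)%N by lia.
    exact: dim_modB (subl _) s0 (lcs0 _) (@lcs_anti _ _ L i.+2) (dLS i (ltnW lei)) d2.
  have := dim_modB sW (subl _) LW WL d1 dW; rewrite subnn => /dim_mod0_sub.
  exact: brackets_sub_center.
have d3 : has_dim (lcs L i.+3) (m - n - i.+1).
  by have := dL i.+3; rewrite addn2 !ltnS subSS subSS; apply; rewrite lei.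
have e : lcs L i.+2 = lcs L i.+3 by apply/seteqP; split=> //; apply: lcs_anti.
rewrite -e in d3; have := dim_mod_unique s0 d2 d3.
lia.
Qed.

End Counting.

(** * The induced presentation of L / Z(L) *)

Section CenterQuotient.
Local Open Scope classical_set_scope.
Variables (F : fieldType) (n : nat) (L : nLieType F n) (P : free_presentation L).

Let Q : nLieType F n := quot (center_ideal L).
Let p : {linear fp_alg P -> Q} := @quot_pi _ _ _ (center_ideal L) \o fp_map P.

Fact quot_center_map_hom : is_hom p.
Proof.
move=> x /=; rewrite (@fp_hom _ _ _ P) -quot_bracketE; congr quot_bracket.
by apply/ffunP => i; rewrite !ffunE.
Qed.

Fact quot_center_map_surj (y : Q) : exists x, p x = y.
Proof.
elim/quot_ind: y => u; have [x <-] := fp_surj P u.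
by exists x.
Qed.

(** The free algebra of [P] is kept; only the kernel grows, from R to S. *)
Definition quot_center_presentation : free_presentation Q :=
  FreePresentation (@fp_free _ _ _ P) quot_center_map_hom quot_center_map_surj.

Lemma quot_center_rel :
  fp_rel quot_center_presentation = fp_map P @^-1` nl_center L.
Proof.
apply/seteqP; split=> x; rewrite /fp_rel /= -(linear0 (@quot_pi _ _ _ (center_ideal L))).
  by move/quot_piP; rewrite subr0.
by move=> Zx; apply/quot_piP; rewrite subr0.
Qed.

End CenterQuotient.

(** * Comparison of the two multipliers *)

Section Multiplier.
Local Open Scope classical_set_scope.
Variables (F : fieldType) (n : nat).
Implicit Types L : nLieType F n.

(** A bracket of n lifts among n is, up to sign, a single one or 0. As L^2 = 0 gives Z(L) = L, S is
    the whole of F and [S, F, ..., F] = F^2. *)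
Lemma multiplier_dim_abelian L : has_dim [set: L] n -> lcs L 2 `<=` [set 0] ->
  exists2 d, (d <= 1)%N &
    multiplier_dim L d /\ multiplier_dim (quot (center_ideal L)) 0.
Proof.
move=> dL L2; have [P] := free_presentation_exists L.
have sR := brackets_subspace (fp_rel P).
have [x xT] := fp_lcs2_generators P dL.
have [||d d1 dd] := @dim_mod_ex _ _ (fp_rel P `&` lcs (fp_alg P) 2)
    (brackets (fp_rel P)) 1 (fun=> bracket [ffun i => x i]) => //.
  move=> v [_]; apply: xT => [||s]; [exact: span_mod_subspace | exact: sub_span_mod |].
  have -> : [ffun i => x (s i)] = [ffun i => [ffun j => x j] (s i)].
    by apply/ffunP => i; rewrite !ffunE.
  apply: bracket_reindex; first exact: span_mod_subspace.
  exact: (span_mod_gen (fun _ : 'I_1 => _) ord0).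
exists d => //; split; first exact: multiplier_dimP dd.
apply: (multiplier_dimP (P := quot_center_presentation P)); apply: dim_mod0.
rewrite quot_center_rel => v [_]; apply: brackets_mono => u _ y i _ _.
by apply: L2; apply: (@brackets_bracket _ _ _ _ _ i).
Qed.

(* With [R] and [S] the kernels of [F -> L] and [F -> L / Z(L)], the two chains *)
(* [R, F, ...] <= R & F^2 <= S & F^2 and [R, F, ...] <= [S, F, ...] <= S & F^2  *)
(* have factors of dimensions d, 1 and k, d'.                                   *)
Lemma multiplier_dim_filiform L m :
    (0 < n)%N -> has_dim [set: L] m -> (n < m)%N ->
    (forall i : nat, (2 <= i <= m - n + 2)%N -> has_dim (lcs L i) (m - n + 2 - i)) ->
  exists d d' k, [/\ multiplier_dim L d, multiplier_dim (quot (center_ideal L)) d',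
    (d + 1 = d' + k)%N & (k <= n)%N].
Proof.
move=> n0 dm nm dL; have [P] := free_presentation_exists L.
have ZE := filiform_center n0 dm nm dL.
set R := fp_rel P; set S := fp_map P @^-1` nl_center L; set F2 := lcs (fp_alg P) 2.
have sR : subspace R by apply: fp_rel_subspace.
have sF2 : subspace F2 by apply: lcs_subspace.
have sRF : subspace (brackets R) by apply: brackets_subspace.
have sSF : subspace (brackets S) by apply: brackets_subspace.
have RS : R `<=` S by move=> v Rv; rewrite /S /= Rv; apply: center0.
have SFR : brackets S `<=` R.
  apply: lspan_min => // _ [y [Sy ->]]; rewrite /R /fp_rel /= (@fp_hom _ _ _ P).
  by apply: (@bracket_center _ _ _ _ (Ordinal n0)); rewrite ffunE; apply: Sy.
have BF2 A : brackets A `<=` F2 by apply: brackets_mono.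
have [z [Zz sz iz]] : has_dim (nl_center L) 1.
  have := dL (m - n).+1; rewrite -ZE addn2 !ltnS subn_gt0 nm leqnSn => /(_ isT).
  by rewrite subSS subSnn.
(* As n < m, L^{m-n+1} lies in L^2, which allows a lift of [z ord0] in F^2. *)
have [s F2s sE] : exists2 s, F2 s & fp_map P s = z ord0.
  apply: fp_map_lcs2_surj; have := Zz ord0; rewrite ZE.
  have : (0 < m - n)%N by rewrite subn_gt0.
  by elim: (m - n)%N => [//|[//|k] IH _] /lcs_anti; apply: IH.
have Ss v : S v -> exists c : 'I_1 -> F, R (v - \sum_(i < 1) c i *: s).
  move=> /sz[c e]; exists c; move: e; rewrite !big_ord1 /R /fp_rel /= => e.
  by rewrite linearB linearZ /= sE.
have d1 : dim_mod (S `&` F2) (R `&` F2) 1.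
  exists (fun=> s); split=> [_|v [Sv F2v]|c [Rc _]].
  - by split=> //; rewrite /S /= sE; apply: Zz.
  - have [c Rc] := Ss v Sv; exists c; split=> //.
    apply: subspaceB => //; apply: subspace_sum => // i; exact: subspaceZ.
  - apply: iz; move: Rc; rewrite /R /fp_rel /= !big_ord1.
    by rewrite linearZ /= sE.
have [N [g F2g]] := fp_lcs2_finite P dm.
have [|d _ dd] := @dim_mod_ex _ _ (R `&` F2) (brackets R) N g sRF.
  by move=> v [_ /F2g].
have [|d' _ dd'] := @dim_mod_ex _ _ (S `&` F2) (brackets S) N g sSF.
  by move=> v [_ /F2g[c Rc]]; exists c; apply: brackets_mono Rc.
have d2 : dim_mod [set: L] (lcs L 2) n.
  have := dL 2; rewrite addn2 !ltnS subSS subSS subn0 => dL2.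
  have L0 : [set 0] `<=` lcs L 2 by move=> _ ->; case: (@lcs_subspace _ _ L 2).
  have := dim_modB (@lcs_subspace _ _ L 2) (@subspace_set0 F L) L0 (fun _ _ => I) dm (dL2 isT).
  by rewrite subKn // ltnW.
have [b [_ sb _]] := d2; have /choice[x xb] := fun i => fp_surj P (b i).
have [h Sh] : exists h : 'I_n -> fp_alg P, brackets S `<=` span_mod h (brackets R).
  apply: (@fp_center_brackets_span _ _ _ P s x) => //; first by rewrite sE; apply: Zz.
  apply: fp_span_mod => v Lv; have [c] := sb v Lv; exists c => /=.
  by under eq_bigr => j _ do rewrite /= xb.
have [k kn dk] := dim_mod_ex sRF Sh.
exists d, d', k; split=> //; first exact: multiplier_dimP dd.
  by apply: (multiplier_dimP (P := quot_center_presentation P)); rewrite quot_center_rel.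
rewrite addnC; apply: (dim_mod_unique sRF).
  apply: dim_mod_add d1 dd; first exact: subspaceI.
    by move=> v Rv; split; [apply/SFR/(brackets_mono RS) | apply: BF2 Rv].
  by move=> v [Rv F2v]; split=> //; apply: RS.
apply: dim_mod_add dd' dk => //; first exact: brackets_mono.
by move=> v Sv; split; [apply/RS/SFR | apply: BF2 Sv].
Qed.

End Multiplier.

Theorem theorem4p14 (F : fieldType) (charF0 : [pchar F] =i pred0)
    (n : nat) (n_ge2 : (2 <= n)%N) (L : nLieType F n) (filL : filiform L) :
  exists (d d' : nat) (t : int),
    [/\ multiplier_dim L d,
        multiplier_dim (quot (center_ideal L)) d',
        d%:Z = d'%:Z + t
      & -1 <= t <= n%:Z - 1].
Proof.
have [m [dm nm dL]] := filL.
have [nltm|mlen] := ltnP n m.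
  have [d [d' [k [dd dd' e kn]]]] := multiplier_dim_filiform (ltnW n_ge2) dm nltm dL.
  (* The bounds on [t = k - 1] are those of [0 <= k <= n]. *)
  by exists d, d', (k%:Z - 1); split=> //; lia.
have mn : m = n by apply/eqP; rewrite eqn_leq mlen nm.
rewrite mn subnn in dm dL.
have [d d1 [dd dd']] := multiplier_dim_abelian dm (dim_mod0_sub (dL 2 isT)).
(* Here [t = d] is 0 or 1, and [1 <= n - 1] because [2 <= n]. *)
by exists d, 0%N, d%:Z; split=> //; lia.
Qed.
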